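(* Let $\mathcal{H}$ be a real Hilbert space and let $\mathcal{P}$ be a class of pairs $(A,B)$ of set-valued operators $A,B:\mathcal{H}\rightrightarrows\mathcal{H}$. Then $\mathcal{P}$ is SRG-full if and only if there exists a nonnegatively homogeneous function $h:\mathbb{R}^3\to\mathbb{R}$ such that, for all pairs of operators $A,B:\mathcal{H}\rightrightarrows\mathcal{H}$: $(A,B)\in\mathcal{P}$ if and only if $$h\big(\|u_A-\bar u_A\|^2,\ \|u_B-\bar u_B\|^2,\ \langle u_A-\bar u_A,u_B-\bar u_B\rangle\big)\leq0$$ for all $(x,u_A),(\bar x,\bar u_A)\in\operatorname{gph}A$ and $(x,u_B),(\bar x,\bar u_B)\in\operatorname{gph}B$.
   Context: A function $h:\mathbb{R}^3\to\mathbb{R}$ is nonnegatively homogeneous if $h(\kappa a,\kappa b,\kappa c)=\kappa h(a,b,c)$ for all $\kappa\geq0$ and all $a,b,c\in\mathbb{R}$. For $A:\mathcal{H}\rightrightarrows\mathcal{H}$, $\operatorname{gph}A=\{(x,u):u\in A(x)\}$ and $\operatorname{dom}A=\{x:A(x)\neq\emptyset\}$. $\overline{\mathbb{C}}=\mathbb{C}\cup\{\infty\}$. Scaled relative graph (SRG) of a pair: for $a,b\in\mathcal{H}$ with $b\neq0$ let $z_\pm(a,b)=\frac{\|a\|}{\|b\|}\exp(\pm i\angle(b,a))$ (a complex-conjugate pair), where $\angle(b,a)=\arccos\frac{\langle b,a\rangle}{\|b\|\|a\|}\in[0,\pi]$ if $a\neq0$ and $b\neq0$, and $\angle(b,a)=0$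 otherwise. For $A,B:\mathcal{H}\rightrightarrows\mathcal{H}$, $\mathcal{G}(A,B)\subseteq\overline{\mathbb{C}}$ consists of all points $z_\pm(u_A-\bar u_A,u_B-\bar u_B)$ (both signs) with $x,\bar x\in\operatorname{dom}A\cap\operatorname{dom}B$, $u_A\in A(x)$, $\bar u_A\in A(\bar x)$, $u_B\in B(x)$, $\bar u_B\in B(\bar x)$ and $u_B\neq\bar u_B$; additionally $\infty\in\mathcal{G}(A,B)$ if and only if there exist $(x,u_A),(\bar x,\bar u_A)\in\operatorname{gph}A$ and $(x,u_B),(\bar x,\bar u_B)\in\operatorname{gph}B$ (possibly $x=\bar x$) with $u_B=\bar u_B$ and $u_A\neq\bar u_A$. For a class $\mathcal{P}$ of operator pairs, $\mathcal{G}(\mathcal{P})=\bigcup_{(A,B)\in\mathcal{P}}\mathcal{G}(A,B)$. The class $\mathcal{P}$ is SRG-full if for every operator pair $(A,B)$: $(A,B)\in\mathcal{P}\iff\mathcal{G}(A,B)\subseteq\mathcal{G}(\mathcal{P})$. *)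

(* Defs.v *)
From mathcomp Require Export all_boot all_order all_algebra.
From mathcomp Require Export all_classical all_reals all_analysis.
From mathcomp Require Export complex.

Set Implicit Arguments.
Unset Strict Implicit.
Unset Printing Implicit Defensive.

Import Order.TTheory GRing.Theory Num.Theory.
Import numFieldNormedType.Exports.
Local Open Scope classical_set_scope.
Local Open Scope ring_scope.

(* A real Hilbert space is a Banach space [H] together with an inner product
   [ip] satisfying [ip_norm ip]. *)
Definition ip_norm (R : realType) (H : completeNormedModType R)
    (ip : {dot H for idfun}) : Prop :=
  forall x : H, `|x| ^+ 2 = ip x x.

Section Operators.
Context (R : realType) (H : completeNormedModType R).

Definition operator : Type := H -> set H.

Definition gph (A : operator) : set (H * H) := [set xu | A xu.1 xu.2].

Definition dom (A : operator) : set H := [set x | A x !=set0].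

End Operators.

Section ScaledRelativeGraph.
Context (R : realType) (H : completeNormedModType R).
Variable ip : {dot H for idfun}.

(* [None] is the point at infinity. *)
Definition extC : Type := one_point_compactification R[i].

Definition angle (b a : H) : R :=
  if (a != 0) && (b != 0) then acos (ip b a / (`|b| * `|a|)) else 0.

Definition exp_i (t : R) : R[i] := (cos t +i* sin t)%C.

(* [zpm false a b] is z_+(a, b) and [zpm true a b] is z_-(a, b). *)
Definition zpm (s : bool) (a b : H) : R[i] :=
  (`|a| / `|b|)%:C%C * exp_i ((-1) ^+ s * angle b a).

Definition srg (A B : operator H) : set extC := fun z =>
  match z with
  | Some w => exists x x' uA uA' uB uB' : H,
      [/\ [/\ (dom A `&` dom B) x & (dom A `&` dom B) x'],
          [/\ A x uA & A x' uA'], [/\ B x uB & B x' uB'],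
          uB <> uB'
        & exists s : bool, w = zpm s (uA - uA') (uB - uB')]
  | None => exists x x' uA uA' uB uB' : H,
      [/\ [/\ gph A (x, uA) & gph A (x', uA')],
          [/\ gph B (x, uB) & gph B (x', uB')],
          uB = uB' & uA <> uA']
  end.

Definition srg_class (P : set (operator H * operator H)) : set extC :=
  \bigcup_(AB in P) srg AB.1 AB.2.

Definition srg_full (P : set (operator H * operator H)) : Prop :=
  forall A B : operator H, P (A, B) <-> srg A B `<=` srg_class P.

End ScaledRelativeGraph.

Definition nonneg_homogeneous (R : realType) (h : R -> R -> R -> R) : Prop :=
  forall k a b c : R, 0 <= k -> h (k * a) (k * b) (k * c) = k * h a b c.

(* Main.v *)
(** A point [z_+(a, b)] or [z_-(a, b)] with [b != 0] carries the same
    information, up to the sign of its imaginary part, as the Gram data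
    [(|a|^2, |b|^2, <a, b>)] of the pair up to a positive scalar: its real part
    is [<a, b> / |b|^2] and its squared modulus is [|a|^2 / |b|^2].  The point
    at infinity corresponds to the ray spanned by [(1, 0, 0)], and the Gram data
    [(0, 0, 0)], which the scaled relative graph does not see, satisfies every
    homogeneous inequality.  Hence an inclusion of scaled relative graphs is an
    inclusion of cones of Gram data, and [h] can be taken to vanish on the cone
    of the class and to be positive elsewhere. *)
Require Import Defs.
From mathcomp Require Import ring.

Import Order.TTheory GRing.Theory Num.Theory.
Import numFieldNormedType.Exports.
Local Open Scope classical_set_scope.
Local Open Scope ring_scope.

Section InnerProduct.
Context {R : realType} {H : completeNormedModType R}.
Context {ip : {dot H for idfun}} (ipH : ip_norm ip).

Lemma ipC (a b : H) : ip a b = ip b a.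
Proof. by rewrite hermC expr0 mul1r. Qed.

Lemma cauchy_schwarz (a b : H) : ip a b ^+ 2 <= `|a| ^+ 2 * `|b| ^+ 2.
Proof.
have [->|b0] := eqVneq b 0; first by rewrite linear0r normr0 !expr0n mulr0.
have b2_gt0 : 0 < ip b b by rewrite -ipH exprn_gt0 // normr_gt0.
(* [w] is [|b|^2] times the component of [a] orthogonal to [b], scaled so as to avoid division. *)
set w := ip b b *: a - ip a b *: b.
have : 0 <= ip w w by rewrite -ipH sqr_ge0.
have -> : ip w w = ip b b * (ip a a * ip b b - ip a b ^+ 2).
  rewrite /w linearBl !linearBr !linearZl_LR !linearZr_LR /= (ipC b a) /GRing.scale /=.
  ring.
by rewrite pmulr_rge0 // subr_ge0 !ipH.
Qed.

(** Eliminates the angle: by Cauchy-Schwarz the argument of [acos] lies in [-1, 1], so its cosine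
    and sine are algebraic. The sign [s] affects only the imaginary part. *)
Lemma zpmE (s : bool) (a b : H) : b != 0 ->
  zpm ip s a b =
  (let c := ip a b / `|b| ^+ 2 in
   c +i* ((-1) ^+ s * Num.sqrt (`|a| ^+ 2 / `|b| ^+ 2 - c ^+ 2)))%C.
Proof.
move=> b0; rewrite /zpm /exp_i /angle b0 andbT /=.
have [->|a0] /= := eqVneq a 0.
  by rewrite linear0l normr0 !expr0n /= !mul0r expr0n subrr sqrtr0 !mulr0.
set x := ip b a / _.
have nb : 0 < `|b| by rewrite normr_gt0.
have na : 0 < `|a| by rewrite normr_gt0.
have x1 : -1 <= x <= 1.
  rewrite -ler_norml -[1]ger0_norm // -ler_sqr ?nnegrE // !real_normK ?num_real//.
  rewrite expr1n expr_div_n ler_pdivrMr ?exprn_gt0 ?mulr_gt0 // mul1r exprMn.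
  exact: cauchy_schwarz.
have -> : cos ((-1) ^+ s * acos x) = x.
  by case: s; rewrite ?expr1 ?expr0 ?mulN1r ?mul1r ?cosN acosK.
have -> : sin ((-1) ^+ s * acos x) = (-1) ^+ s * Num.sqrt (1 - x ^+ 2).
  by case: s; rewrite ?expr1 ?expr0 ?mulN1r ?mul1r ?sinN sin_acos.
have -> : ip a b / `|b| ^+ 2 = `|a| / `|b| * x.
  by rewrite /x ipC; field; rewrite !gt_eqF.
have -> : `|a| ^+ 2 / `|b| ^+ 2 - (`|a| / `|b| * x) ^+ 2 =
          (`|a| / `|b|) ^+ 2 * (1 - x ^+ 2) by field; rewrite gt_eqF.
rewrite sqrtrM ?sqr_ge0 // sqrtr_sqr ger0_norm ?divr_ge0 ?ltW //.
by apply/eqP; rewrite eq_complex /=; apply/andP; split; apply/eqP; ring.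
Qed.

Lemma gram_of_zpm {s s' : bool} {a b a' b' : H} : b != 0 -> b' != 0 ->
  zpm ip s a b = zpm ip s' a' b' ->
  let k := `|b| ^+ 2 / `|b'| ^+ 2 in
  [/\ `|a| ^+ 2 = k * `|a'| ^+ 2, `|b| ^+ 2 = k * `|b'| ^+ 2
    & ip a b = k * ip a' b'].
Proof.
move=> b0 b'0; rewrite !zpmE //= => -[re im].
have nb : `|b| != 0 by rewrite normr_eq0.
have nb' : `|b'| != 0 by rewrite normr_eq0.
have radicand_ge0 (u v : H) : v != 0 ->
    0 <= `|u| ^+ 2 / `|v| ^+ 2 - (ip u v / `|v| ^+ 2) ^+ 2.
  rewrite -normr_gt0 => nv.
  rewrite subr_ge0 expr_div_n ler_pdivrMr ?exprn_gt0 //.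
  have -> : `|u| ^+ 2 / `|v| ^+ 2 * (`|v| ^+ 2) ^+ 2 = `|u| ^+ 2 * `|v| ^+ 2.
    by field; rewrite gt_eqF.
  exact: cauchy_schwarz.
(* Squaring removes the signs, so [s] and [s'] may differ, and also the roots, whose radicands are
   nonnegative. The equal squared real parts then cancel. *)
move/(congr1 (fun t => t ^+ 2)): im.
rewrite [LHS]exprMn [RHS]exprMn !sqrr_sign !mul1r !sqr_sqrtr ?radicand_ge0 // re => /addIr mod2.
split; last 2 first.
- by field.
- by rewrite mulrAC -mulrA -re; field.
- by rewrite mulrAC -mulrA -mod2; field.
Qed.

(** The quotients in [zpmE] are invariant under a common factor [k], which [b != 0] forces to be
    nonzero. *)
Lemma zpm_of_gram {s : bool} {k : R} {a b a' b' : H} : b != 0 ->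
  `|a| ^+ 2 = k * `|a'| ^+ 2 -> `|b| ^+ 2 = k * `|b'| ^+ 2 ->
  ip a b = k * ip a' b' ->
  b' != 0 /\ zpm ip s a b = zpm ip s a' b'.
Proof.
move=> b0 eqa eqb eqab.
have : k * `|b'| ^+ 2 != 0 by rewrite -eqb expf_neq0 // normr_eq0.
rewrite mulf_eq0 negb_or expf_eq0 /= normr_eq0 => /andP[k0 b'0].
split=> //; rewrite !zpmE // eqa eqb eqab.
by rewrite -!mulf_div divff // !mul1r.
Qed.

End InnerProduct.

Section GramCone.
Context {R : realType} {H : completeNormedModType R}.

Definition increments (A B : operator H) : set (H * H) := fun d =>
  exists x x' uA uA' uB uB' : H,
    [/\ A x uA /\ A x' uA', B x uB /\ B x' uB' & d = (uA - uA', uB - uB')].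

Context (ip : {dot H for idfun}) (ipH : ip_norm ip).

Lemma srg_SomeP (A B : operator H) (w : R[i]) :
  srg ip A B (Some w) <->
  exists a b s, [/\ increments A B (a, b), b != 0 & w = zpm ip s a b].
Proof.
split=> [|].
  move=> [x [x' [uA [uA' [uB [uB' [_ hA hB neq [s ->]]]]]]]].
  exists (uA - uA'), (uB - uB'), s; split=> //.
    by exists x, x', uA, uA', uB, uB'.
  by rewrite subr_eq0; apply/eqP.
move=> [a [b [s [[x [x' [uA [uA' [uB [uB' [hA hB [-> ->]]]]]]]] neq ->]]]].
exists x, x', uA, uA', uB, uB'; split=> //; last 2 first.
- by move: neq; rewrite subr_eq0 => /eqP.
- by exists s.
- by case: hA hB => ? ? [? ?]; split; split; [exists uA|exists uB|exists uA'|exists uB'].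
Qed.

Lemma srg_NoneP (A B : operator H) :
  srg ip A B None <-> exists2 a, increments A B (a, 0) & a != 0.
Proof.
split=> [|].
  move=> [x [x' [uA [uA' [uB [uB' [hA hB eqB neq]]]]]]].
  exists (uA - uA'); last by rewrite subr_eq0; apply/eqP.
  by exists x, x', uA, uA', uB, uB'; rewrite eqB subrr -{1}eqB.
move=> [a [x [x' [uA [uA' [uB [uB' [hA hB [-> /esym/eqP]]]]]]]]].
rewrite !subr_eq0 => /eqP eqB /eqP neq.
by exists x, x', uA, uA', uB, uB'.
Qed.

(** A union of rays from the origin, with no convexity imposed. *)
Definition gram_cone (P : set (operator H * operator H)) (p q r : R) : Prop :=
  exists k AB a b, [/\ 0 <= k, P AB, increments AB.1 AB.2 (a, b) &
    [/\ p = k * `|a| ^+ 2, q = k * `|b| ^+ 2 & r = k * ip a b]].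

Lemma gram_coneZ P {k p q r : R} : 0 <= k ->
  gram_cone P p q r -> gram_cone P (k * p) (k * q) (k * r).
Proof.
move=> k0 [l [AB [a [b [l0 PAB incr [-> -> ->]]]]]].
exists (k * l), AB, a, b.
by split; [exact: mulr_ge0| | |rewrite !mulrA].
Qed.

(** Increments with [b != 0] correspond to finite points, those with [b = 0] and [a != 0] to
    infinity; [(0, 0)] yields no point and is excluded. *)
Lemma srg_sub_classP (P : set (operator H * operator H)) (A B : operator H) :
  srg ip A B `<=` srg_class ip P <->
  forall a b, increments A B (a, b) -> (a, b) != (0, 0) ->
    gram_cone P (`|a| ^+ 2) (`|b| ^+ 2) (ip a b).
Proof.
split=> [sub a b|cone [w|]].
- have [->|b0] := eqVneq b 0 => incr neq; last first.
    have /sub[AB PAB] : srg ip A B (Some (zpm ip false a b)).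
      by apply/srg_SomeP; exists a, b, false.
    move=> /srg_SomeP[a' [b' [s' [incr' b'0 eqz]]]].
    exists (`|b| ^+ 2 / `|b'| ^+ 2), AB, a', b'.
    by split; rewrite ?divr_ge0 ?sqr_ge0 //; apply: gram_of_zpm eqz.
  move: neq; rewrite xpair_eqE eqxx andbT => a0.
  have /sub[AB PAB] : srg ip A B None.
    by apply: (srg_NoneP _ _).2; exists a.
  move=> /(srg_NoneP _ _).1[a' incr' a'0].
  (* At infinity only the first Gram coordinate is nonzero, so any two such increments are
     proportional. *)
  exists (`|a| ^+ 2 / `|a'| ^+ 2), AB, a', 0.
  split; rewrite ?divr_ge0 ?sqr_ge0 // !linear0r normr0 expr0n !mulr0.
  by split=> //; rewrite divfK // expf_neq0 // normr_eq0.
- move=> /srg_SomeP[a [b [s [incr b0 ->]]]].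
  have [|k [AB [a' [b' [k0 PAB incr' [eqa eqb eqab]]]]]] := cone _ _ incr.
    by rewrite xpair_eqE (negPf b0) andbF.
  have [b'0 ->] := zpm_of_gram (s := s) ipH b0 eqa eqb eqab.
  by exists AB => //; apply/srg_SomeP; exists a', b', s.
- move=> /(srg_NoneP _ _).1[a incr a0].
  have [|k [AB [a' [b' [k0 PAB incr' [eqa eqb _]]]]]] := cone _ _ incr.
    by rewrite xpair_eqE (negPf a0).
  have : k * `|a'| ^+ 2 != 0 by rewrite -eqa expf_neq0 // normr_eq0.
  rewrite mulf_eq0 negb_or expf_eq0 /= normr_eq0 => /andP[kn0 a'0].
  exists AB => //; apply: (srg_NoneP _ _).2; exists a' => //.
  (* As [k] is nonzero, [0 = k * |b'|^2] gives [b' = 0], so the class also reaches infinity. *)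
  move/esym/eqP: eqb; rewrite normr0 expr0n mulf_eq0 (negPf kn0) expf_eq0 /=.
  by rewrite normr_eq0 => /eqP b'0; rewrite b'0 in incr'.
Qed.

Lemma incrementsP (Q : H -> H -> Prop) (A B : operator H) :
  (forall x x' uA uA' uB uB' : H,
     gph A (x, uA) -> gph A (x', uA') -> gph B (x, uB) -> gph B (x', uB') ->
     Q (uA - uA') (uB - uB')) <->
  (forall a b, increments A B (a, b) -> Q a b).
Proof.
split=> [hQ a b [x [x' [uA [uA' [uB [uB' [[? ?] [? ?] [-> ->]]]]]]]]|].
  exact: (hQ x x').
move=> hQ x x' uA uA' uB uB' hA hA' hB hB'; apply: hQ.
by exists x, x', uA, uA', uB, uB'.
Qed.

End GramCone.

Theorem mainTheorem3 (R : realType) (H : completeNormedModType R)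
    (ip : {dot H for idfun}) (ipH : ip_norm ip)
    (P : set (operator H * operator H)) :
  srg_full ip P <->
  exists h : R -> R -> R -> R,
    nonneg_homogeneous h /\
    forall A B : operator H,
      P (A, B) <->
      forall x x' uA uA' uB uB' : H,
        gph A (x, uA) -> gph A (x', uA') ->
        gph B (x, uB) -> gph B (x', uB') ->
        h (`|uA - uA'| ^+ 2) (`|uB - uB'| ^+ 2) (ip (uA - uA') (uB - uB')) <= 0.
Proof.
split=> [full|[h [hom hP]] A B].
  pose h p q r : R :=
    if `[< gram_cone ip P p q r >] then 0 else `|p| + `|q| + `|r|.
  exists h; split=> [k p q r|A B].
    (* Scaling by [0] may change membership in the cone, but both branches of [h] vanish at the
       origin. For [k > 0] membership is preserved both ways, using [k^-1] for the converse. *)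
    rewrite le_eqVlt => /predU1P[<-|k_gt0].
      by rewrite /h !mul0r normr0 !addr0 if_same.
    have -> : h (k * p) (k * q) (k * r) =
        if `[< gram_cone ip P p q r >] then 0 else `|k * p| + `|k * q| + `|k * r|.
      congr (if _ then _ else _); apply: asbool_equiv_eq.
      split=> [|]; last by apply: gram_coneZ; exact: ltW.
      have kV_ge0 : 0 <= k^-1 by rewrite invr_ge0 ltW.
      by move=> /(gram_coneZ _ _ kV_ge0); rewrite !mulKf ?gt_eqF.
    rewrite /h; case: ifP => _; first by rewrite mulr0.
    by rewrite !normrM (gtr0_norm k_gt0) !mulrDr.
  rewrite (incrementsP (fun a b => h (`|a| ^+ 2) (`|b| ^+ 2) (ip a b) <= 0)).
  split=> [PAB a b incr|hle].
    rewrite /h ifT //; apply/asboolP.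
    by exists 1, (A, B), a, b; rewrite !mul1r.
  apply/full/srg_sub_classP => // a b /hle + neq.
  (* Off the cone [h] is at least [|a|^2 + |b|^2], which is positive for a nonzero pair. *)
  rewrite /h; case: asboolP => // _; rewrite leNgt => /negP[].
  rewrite ltr_wpDr // lt_neqAle addr_ge0 // andbT eq_sym paddr_eq0 //.
  by rewrite !normr_eq0 !expf_eq0 /= !normr_eq0 -xpair_eqE.
split=> [PAB z Az|/(srg_sub_classP ip ipH) cone]; first by exists (A, B).
apply/hP/(incrementsP (fun a b => h (`|a| ^+ 2) (`|b| ^+ 2) (ip a b) <= 0)).
move=> a b incr; have [[-> ->]|neq] := eqVneq (a, b) (0, 0).
  (* Homogeneity with factor [0] forces [h 0 0 0 = 0], which settles the pair that the graph does
     not see. *)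
  have := hom 0 0 0 0 (lexx 0); rewrite !mul0r => h0.
  by rewrite linear0r normr0 expr0n h0.
have [k [[A' B'] [a' [b' [k0 PAB' incr' [-> -> ->]]]]]] := cone _ _ incr neq.
rewrite hom //; apply: mulr_ge0_le0 => //.
move/hP: PAB'.
move/(incrementsP (fun a b => h (`|a| ^+ 2) (`|b| ^+ 2) (ip a b) <= 0)).
exact.
Qed.
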